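(* The algorithm described in the context (input: a social trust network $G=(V,E)$, a budget $\mu$, and internal opinions $s$; output: the modification $\Delta s$ of the internal opinions) outputs the optimal result of the internal opinion problem $$\max\ \mathbf{1}^{\mathrm T}\bigl(\Lambda+(I-\Lambda)L\bigr)^{-1}\Lambda(s+\Delta s)\quad\text{s.t.}\quad -1\le s_i+\Delta s_i\le 1\ (i=1,\ldots,n),\quad \|\Delta s\|_1\le\mu .$$
   Context: A social trust network is represented by a directed signed weighted graph $G=(V,E)$ with $V=\{1,\ldots,n\}$, where each arc $(i,j)\in E$ carries a weight $\omega_{ij}$ (a nonzero real number, positive or negative). The adjacency matrix $A=(a_{ij})$ has $a_{ij}=\omega_{ij}$ if $(i,j)\in E$ and $a_{ij}=0$ otherwise; $D$ is the diagonal matrix with $d_{ii}=\sum_{j=1}^n|a_{ij}|$; $L=D-A$ is the Laplacian matrix. $\Lambda=\mathrm{diag}(\alpha_1,\ldots,\alpha_n)$, where $\alpha_i$, a number with values in $[0,1]$, is the confidence index of node $i$. $I$ is the $n\times n$ identity matrix and $\mathbf{1}$ is the all-ones column vector. $s$ is the vector of internal opinions $s_i$, with values in $[-1,1]$; $\mu$ is the budget amount. In the internal opinion problem, $G$, $s$ and $\mu$ are given and the modification $\Delta s$ is sought. Algorithm (input: $G$, budget $\mu$, randomly generated internal opinions $s$). Compute the contribution indices $g_i=\bigl(\mathbf{1}^{\mathrm T}(\Lambda+(I-\Lambda)L)^{-1}\Lambda\bigr)_i$. Set $\mathrm{sign}=g_i/|g_i|$ (for node $i$). While $\mu>0$: find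 the largest $|g_i|$, and put $\mathrm{cost}=1-\mathrm{sign}\cdot s_i$; if $\mathrm{cost}>\mu$, set $\Delta s_i=\mathrm{sign}\cdot\mu$ and $\mu=0$; otherwise set $\Delta s_i=\mathrm{sign}\cdot\mathrm{cost}$ and $\mu=\mu-\mathrm{cost}$. Output: the modification $\Delta s$.
   Formalization: The largest |g_i| is sought only among nodes not yet treated, the loop also stops once all nodes are treated, sign is taken as 0 when g_i = 0, and the budget is assumed nonnegative and the matrix Λ+(I−Λ)L invertible. *)

(* Defs.v *)
From HB Require Import structures.
From Stdlib Require Export Relation_Operators.
From mathcomp Require Export all_boot all_order all_algebra.

Set Implicit Arguments.
Unset Strict Implicit.
Unset Printing Implicit Defensive.

Import Order.TTheory GRing.Theory Num.Theory.
Local Open Scope ring_scope.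

(* [weight] matters only on arcs.  Loops are allowed. *)
Record trust_network (R : realFieldType) (n : nat) := TrustNetwork {
  arc : rel 'I_n;
  weight : 'I_n -> 'I_n -> R;
  weight_neq0 : forall i j, arc i j -> weight i j != 0
}.

Section Opinion.
Variables (R : realFieldType) (n : nat).
Implicit Types (G : trust_network R n) (alpha : 'rV[R]_n) (s ds : 'cV[R]_n).

Definition adjacency G : 'M[R]_n :=
  \matrix_(i, j) if arc G i j then weight G i j else 0.

Definition degree G : 'M[R]_n :=
  diag_mx (\row_i \sum_j `|adjacency G i j|).

Definition laplacian G : 'M[R]_n := degree G - adjacency G.

Definition confidence alpha : 'M[R]_n := diag_mx alpha.

Definition ones : 'cV[R]_n := const_mx 1.

Definition system_mx G alpha : 'M[R]_n :=
  confidence alpha + (1%:M - confidence alpha) *m laplacian G.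

Definition l1norm (x : 'cV[R]_n) : R := \sum_i `|x i 0|.

Definition objective G alpha s ds : R :=
  (ones^T *m invmx (system_mx G alpha) *m confidence alpha *m (s + ds)) 0 0.

Definition feasible s (mu : R) ds : Prop :=
  (forall i, -1 <= s i 0 + ds i 0 <= 1) /\ l1norm ds <= mu.

Definition optimal G alpha s (mu : R) ds : Prop :=
  feasible s mu ds /\
  forall ds', feasible s mu ds' -> objective G alpha s ds' <= objective G alpha s ds.

Definition contribution G alpha (i : 'I_n) : R :=
  (ones^T *m invmx (system_mx G alpha) *m confidence alpha) 0 i.

(* Division is total: a node with zero contribution gets sign 0, hence
   modification 0. *)
Definition sign G alpha (i : 'I_n) : R :=
  contribution G alpha i / `|contribution G alpha i|.

Definition cost G alpha s (i : 'I_n) : R := 1 - sign G alpha i * s i 0.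

(* The contribution indices never change during the loop, so "find the largest
   |g_i|" has to range over the nodes not treated yet. *)
Record state := State {
  unvisited : {set 'I_n};
  budget : R;
  modification : 'cV[R]_n
}.

Definition set_entry ds (i : 'I_n) (x : R) : 'cV[R]_n :=
  \col_k (if k == i then x else ds k 0).

Definition visit G alpha s (st : state) (i : 'I_n) : state :=
  let mu := budget st in
  let c := cost G alpha s i in
  let sg := sign G alpha i in
  if mu < c
  then State (unvisited st :\ i) 0 (set_entry (modification st) i (sg * mu))
  else State (unvisited st :\ i) (mu - c)
             (set_entry (modification st) i (sg * c)).

(* One loop iteration.  Ties for the largest |g_i| are broken arbitrarily, so
   this is a relation. *)
Inductive iteration G alpha s : state -> state -> Prop :=
| Iteration (st : state) (i : 'I_n) :
    0 < budget st ->
    i \in unvisited st ->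
    (forall j, j \in unvisited st ->
       `|contribution G alpha j| <= `|contribution G alpha i|) ->
    iteration G alpha s st (visit G alpha s st i).

(* The loop also ends when every node has been treated. *)
Definition halted (st : state) : Prop :=
  ~~ (0 < budget st) \/ unvisited st = set0.

Definition initial (mu : R) : state := State [set: 'I_n] mu 0.

Definition algorithm_outputs G alpha s (mu : R) ds : Prop :=
  exists st : state,
    [/\ clos_refl_trans_1n state (iteration G alpha s) (initial mu) st,
        halted st & modification st = ds].

(* There is no infinite run, whatever the tie-breaking. *)
Definition algorithm_terminates G alpha s (mu : R) : Prop :=
  Acc (fun st' st => iteration G alpha s st st') (initial mu).

End Opinion.

(* Main.v *)
Require Import Defs.
From mathcomp Require Import lra.

(** Only the linear functional [ds |-> \sum_i g_i ds_i] matters, and maximising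
    it is a fractional knapsack problem.  Optimality of the greedy choice is
    certified by a Lagrange multiplier [lam] of the budget constraint: if every
    entry of [ds] maximises [x |-> g_i x - lam |x|] over its box and
    [lam (mu - |ds|_1) = 0], then [ds] is optimal.  During the run the
    multiplier is [|g_i|] for the last treated node [i]; if the nodes run out
    before the budget, it is [0]. *)

Import Order.TTheory GRing.Theory Num.Theory.
Local Open Scope ring_scope.

Section Greedy.
Set Implicit Arguments.
Unset Strict Implicit.
Variables (R : realFieldType) (n : nat) (G : trust_network R n).
Variables (alpha : 'rV[R]_n) (s : 'cV[R]_n).
Hypothesis hs : forall i, -1 <= s i 0 <= 1.

Local Notation g := (contribution G alpha).
Local Notation sg := (sign G alpha).
Local Notation c := (cost G alpha s).
Local Notation step := (iteration G alpha s).

(** * Signs, costs and single entries of the modification *)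

Lemma signP i :
  [\/ g i = 0 /\ sg i = 0, 0 < g i /\ sg i = 1 | g i < 0 /\ sg i = -1].
Proof.
rewrite /sign; case: (ltrgtP (g i) 0) => [g_lt0|g_gt0|->].
- by apply: Or33; rewrite ltr0_norm // invrN mulrN divff ?lt_eqF.
- by apply: Or32; rewrite gtr0_norm // divff ?gt_eqF.
- by apply: Or31; rewrite mul0r.
Qed.

Lemma cost_ge0 i : 0 <= c i.
Proof.
have := hs i; rewrite /cost.
by case: (signP i) => -[_ ->] /andP[]; lra.
Qed.

(** For a nonzero sign, [c i] is the distance from [s i 0] to the end of the box that the sign
    points to. *)
Lemma sign_mod_box i y : 0 <= y <= c i -> -1 <= s i 0 + sg i * y <= 1.
Proof.
have := hs i; rewrite /cost.
by case: (signP i) => -[_ ->] /andP[? ?] /andP[? ?]; apply/andP; split; lra.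
Qed.

Lemma contribution_sign_mod i y :
  0 <= y -> g i * (sg i * y) = `|g i| * `|sg i * y|.
Proof.
move=> y_ge0; rewrite normrM (ger0_norm y_ge0).
case: (signP i) => -[gi ->].
- by rewrite gi !mul0r normr0 mul0r.
- by rewrite normr1 (gtr0_norm gi).
- by rewrite normrN1 (ltr0_norm gi) mulN1r mul1r mulrN mulNr.
Qed.

(** Equality can fail only at [g i = 0], where the sign is 0. *)
Lemma norm_sign_mod_le i y : 0 <= y -> `|sg i * y| <= y.
Proof.
move=> y_ge0; rewrite normrM (ger0_norm y_ge0).
by case: (signP i) => -[_ ->]; rewrite ?normr0 ?normrN1 ?normr1; lra.
Qed.

Lemma norm_sign_mod i y : 0 <= y -> g i != 0 -> `|sg i * y| = y.
Proof.
move=> y_ge0; rewrite normrM (ger0_norm y_ge0).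
by case: (signP i) => -[gi ->]; rewrite ?gi ?eqxx // ?normrN1 ?normr1 mul1r.
Qed.

(** Merges the two branches: a visit always spends the smaller of budget and cost. *)
Lemma visitE st i :
  visit G alpha s st i =
  State (unvisited st :\ i) (budget st - Num.min (budget st) (c i))
        (set_entry (modification st) i (sg i * Num.min (budget st) (c i))).
Proof. by rewrite /visit; case: ltP; rewrite ?subrr. Qed.

Lemma l1norm_set_entry (ds : 'cV[R]_n) i x :
  ds i 0 = 0 -> l1norm (set_entry ds i x) = l1norm ds + `|x|.
Proof.
move=> dsi0; rewrite /l1norm (bigD1 i) //= [in RHS](bigD1 i) //=.
rewrite dsi0 normr0 add0r addrC mxE eqxx; congr (_ + _).
by apply: eq_bigr => k /negPf ki; rewrite mxE ki.
Qed.

Lemma objectiveE ds :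
  objective G alpha s ds = \sum_i g i * s i 0 + \sum_i g i * ds i 0.
Proof.
rewrite /objective mxE -big_split /=; apply: eq_bigr => i _.
by rewrite [(s + ds) _ _]mxE mulrDr.
Qed.

(** * Termination and existence of a complete run *)

Lemma iteration_unvisited st st' :
  step st st' -> (#|unvisited st'| < #|unvisited st|)%N.
Proof.
case=> {}st i _ iU _; rewrite visitE /=.
by rewrite [X in (_ < X)%N](cardsD1 i) iU.
Qed.

Lemma iteration_Acc st : Acc (fun st' st => step st st') st.
Proof.
have [k] := ubnP #|unvisited st|; elim: k st => [st|k IH st ltk].
  by rewrite ltn0.
constructor=> st' /iteration_unvisited lt_st'.
by apply: IH; apply: (leq_trans lt_st'); rewrite -ltnS.
Qed.

Lemma halted_or_iteration st : halted st \/ exists st', step st st'.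
Proof.
have [b_gt0|] := boolP (0 < budget st); last by left; left.
have [U0|[i0 i0U]] := set_0Vmem (unvisited st); first by left; right.
right; case: (arg_maxP (fun j => `|g j|) i0U) => i iU imax.
by exists (visit G alpha s st i); constructor.
Qed.

Lemma exists_run st :
  exists st', clos_refl_trans_1n (state R n) step st st' /\ halted st'.
Proof.
elim: (iteration_Acc st) => {}st _ IH.
have [st_halted|[st1 st_st1]] := halted_or_iteration st.
  by exists st; split=> //; apply: rt1n_refl.
have [st' [run' halt']] := IH _ st_st1.
by exists st'; split=> //; apply: rt1n_trans st_st1 run'.
Qed.

Variable mu : R.

(** * Sufficient conditions for optimality *)

Lemma optimal_of_multiplier ds lam :
    feasible s mu ds -> 0 <= lam -> lam * (mu - l1norm ds) = 0 ->
    (forall i x, -1 <= s i 0 + x <= 1 ->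
       g i * x - lam * `|x| <= g i * ds i 0 - lam * `|ds i 0|) ->
  optimal G alpha s mu ds.
Proof.
move=> ds_feas lam_ge0 slack local_max; split=> // ds' [box' norm'].
rewrite !objectiveE lerD2l.
have : \sum_i (g i * ds' i 0 - lam * `|ds' i 0|)
       <= \sum_i (g i * ds i 0 - lam * `|ds i 0|).
  by apply: ler_sum => i _; apply: local_max.
rewrite !sumrB -!mulr_sumr -/(l1norm _) -/(l1norm _).
have : lam * l1norm ds' <= lam * mu by apply: ler_wpM2l.
move: slack; rewrite mulrBr; lra.
Qed.

(** Each unit moved along the sign gains [|g i| - lam >= 0], and the box allows at most [c i]
    units. *)
Lemma local_max_full i lam x :
    0 <= lam <= `|g i| -> -1 <= s i 0 + x <= 1 ->
  g i * x - lam * `|x| <= g i * (sg i * c i) - lam * `|sg i * c i|.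
Proof.
move=> /andP[lam_ge0 lam_le] /andP[x_ge x_le].
rewrite contribution_sign_mod ?cost_ge0 //.
have [gi0|gi_neq0] := eqVneq (g i) 0.
  have -> : lam = 0 by move: lam_le; rewrite gi0 normr0; lra.
  by rewrite gi0 normr0 !mul0r.
rewrite (norm_sign_mod (cost_ge0 i) gi_neq0) -mulrBl.
have -> : g i * x = `|g i| * (sg i * x).
  case: (signP i) => -[gi ->]; first by rewrite gi eqxx in gi_neq0.
    by rewrite gtr0_norm // mul1r.
  by rewrite ltr0_norm // mulN1r mulrNN.
have sgx_le_norm : sg i * x <= `|x|.
  apply: le_trans (ler_norm _) _; rewrite normrM.
  by case: (signP i) => -[_ ->];
    rewrite ?normr0 ?normrN1 ?normr1 ?mul0r ?mul1r.
have sgx_le_cost : sg i * x <= c i.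
  rewrite /cost; case: (signP i) => -[gi ->]; lra.
have := ler_wpM2l lam_ge0 sgx_le_norm.
have : (`|g i| - lam) * (sg i * x) <= (`|g i| - lam) * c i.
  by apply: ler_wpM2l => //; rewrite subr_ge0.
rewrite mulrBl; lra.
Qed.

(** At the price [|a|] the maximum is 0, attained by any [m] aligned with [a]; this covers a node at
    which the budget ran out. *)
Lemma local_max_boundary (a lam m x : R) :
    `|a| = lam -> a * m = `|a| * `|m| ->
  a * x - lam * `|x| <= a * m - lam * `|m|.
Proof.
move=> <- ->; rewrite subrr subr_le0 -normrM; exact: ler_norm.
Qed.

(** A price of at least [|a|] makes no move profitable; this covers untreated nodes. *)
Lemma local_max_zero (a lam x : R) :
  `|a| <= lam -> a * x - lam * `|x| <= a * 0 - lam * `|0 : R|.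
Proof.
move=> a_le; rewrite normr0 !mulr0 subrr subr_le0.
by apply: le_trans (ler_norm _) _; rewrite normrM ler_wpM2r.
Qed.

(** * The loop invariant and its consequences *)

(* A treated node with zero contribution spends budget without changing [ds];
   this is why [inv_slack] carries the factor [lam]. *)
Record greedy_inv (lam : R) (st : state R n) : Prop := GreedyInv {
  inv_lam : 0 <= lam;
  inv_budget : 0 <= budget st;
  inv_box : forall i, -1 <= s i 0 + modification st i 0 <= 1;
  inv_aligned : forall i,
    g i * modification st i 0 = `|g i| * `|modification st i 0|;
  inv_unvisited : forall i, i \in unvisited st ->
    modification st i 0 = 0 /\ `|g i| <= lam;
  inv_visited : forall i, i \notin unvisited st ->
    lam <= `|g i| /\
    (modification st i 0 = sg i * c i \/ budget st = 0 /\ `|g i| = lam);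
  inv_l1norm : l1norm (modification st) + budget st <= mu;
  inv_slack : lam * (mu - (l1norm (modification st) + budget st)) = 0
}.

(** Any common upper bound of the [|g i|] can start the run; the sum is a convenient one. *)
Lemma greedy_inv_initial :
  0 <= mu -> greedy_inv (\sum_i `|g i|) (initial n mu).
Proof.
move=> mu_ge0.
have l1_0 : l1norm (0 : 'cV[R]_n) = 0.
  by apply: big1 => i _; rewrite mxE normr0.
split=> //= [|i|i|i _|i||].
- exact: sumr_ge0.
- by rewrite mxE addr0.
- by rewrite mxE normr0 !mulr0.
- by rewrite mxE (bigD1 i) //= lerDl; split=> //; apply: sumr_ge0.
- by rewrite inE.
- by rewrite l1_0 add0r.
- by rewrite l1_0 add0r subrr mulr0.
Qed.

Lemma greedy_inv_step lam st st' :
  greedy_inv lam st -> step st st' -> exists lam', greedy_inv lam' st'.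
Proof.
move=> inv st_st'; case: st_st' inv => {st'}st i b_gt0 iU imax inv.
have [mi0 gi_le] := inv_unvisited inv iU.
have c_ge0 := cost_ge0 i.
(* By [imax] this bounds the remaining nodes from above; being at most [lam], it bounds the treated
   ones from below. *)
exists `|g i|; rewrite visitE; set y := Num.min _ _.
have y_ge0 : 0 <= y by rewrite le_min (inv_budget inv).
have y_le_b : y <= budget st by rewrite ge_min lexx.
have y_le_c : y <= c i by rewrite ge_min lexx orbT.
split=> //= [|k|k|k|k||].
- by rewrite subr_ge0.
- rewrite mxE; case: eqP => [->|_]; last exact: inv_box inv k.
  by apply: sign_mod_box; rewrite y_ge0.
- rewrite mxE; case: eqP => [->|_]; last exact: inv_aligned inv k.
  exact: contribution_sign_mod.
- rewrite !inE mxE => /andP[/negPf-> kU].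
  by have [-> _] := inv_unvisited inv kU; split=> //; apply: imax.
- rewrite !inE mxE negb_and negbK; case: eqP => [-> _|_ /= kU].
    split=> //; case: (ltP (budget st) (c i)) => [lt_bc|le_cb].
      by right; rewrite /y min_l ?subrr ?ltW.
    by left; rewrite /y min_r.
  have [lam_le [full|[b0 _]]] := inv_visited inv kU.
    by split; [apply: le_trans lam_le | left].
  by rewrite b0 ltxx in b_gt0.
- have := norm_sign_mod_le i y_ge0; have := inv_l1norm inv.
  by rewrite l1norm_set_entry //; lra.
- rewrite l1norm_set_entry //.
  have [->|gi_neq0] := eqVneq (g i) 0; first by rewrite normr0 mul0r.
  (* Since [0 < |g i| <= lam], the old slackness says that no budget was wasted so far, and this
     visit wastes none. *)
  have lam_neq0 : lam != 0.
    by rewrite gt_eqF // (lt_le_trans _ gi_le) // normr_gt0.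
  rewrite norm_sign_mod //.
  have /eqP := inv_slack inv; rewrite mulf_eq0 (negPf lam_neq0) /= => /eqP sl.
  have -> : mu - (l1norm (modification st) + y + (budget st - y)) = 0 by lra.
  by rewrite mulr0.
Qed.

Lemma greedy_inv_run lam st st' :
    clos_refl_trans_1n (state R n) step st st' -> greedy_inv lam st ->
  exists lam', greedy_inv lam' st'.
Proof.
move=> run; elim: run lam => {st st'}[st|st1 st2 st3 st12 _ IH] lam inv.
  by exists lam.
have [lam' inv'] := greedy_inv_step inv st12; exact: IH inv'.
Qed.

Lemma greedy_inv_optimal lam st :
  greedy_inv lam st -> halted st -> optimal G alpha s mu (modification st).
Proof.
move=> inv st_halted.
have feas : feasible s mu (modification st).
  split=> [i|]; first exact: inv_box inv i.
  by have := inv_l1norm inv; have := inv_budget inv; lra.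
(* With the budget exhausted, the multiplier of the invariant serves: untreated, filled and partly
   filled nodes each have their local lemma. *)
have [b_gt0|] := boolP (0 < budget st); last first.
  rewrite lt_neqAle (inv_budget inv) andbT negbK => /eqP b0.
  have slack := inv_slack inv; rewrite -b0 addr0 in slack.
  apply: (optimal_of_multiplier feas (inv_lam inv) slack) => i x x_box.
  have [iU|iV] := boolP (i \in unvisited st).
    by have [-> gi_le] := inv_unvisited inv iU; apply: local_max_zero.
  have [lam_le [->|[_ gi_eq]]] := inv_visited inv iV.
    by apply: local_max_full => //; rewrite (inv_lam inv).
  exact: local_max_boundary gi_eq (inv_aligned inv i).
case: st_halted => [|U0]; first by rewrite b_gt0.
(* Budget is left over, so every node is treated and filled, and the multiplier 0 suffices. *)
apply: (optimal_of_multiplier feas (lexx 0)) => [|i x x_box].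
  by rewrite mul0r.
have iV : i \notin unvisited st by rewrite U0 inE.
have [_ [->|[b0 _]]] := inv_visited inv iV; last by rewrite b0 ltxx in b_gt0.
by apply: local_max_full; rewrite ?lexx ?normr_ge0.
Qed.

End Greedy.

Theorem theorem3p1 (R : realFieldType) (n : nat) (G : trust_network R n)
    (alpha : 'rV[R]_n) (s : 'cV[R]_n) (mu : R)
    (halpha : forall i : 'I_n, 0 <= alpha 0 i <= 1)
    (hs : forall i : 'I_n, -1 <= s i 0 <= 1)
    (hmu : 0 <= mu)
    (hinv : system_mx G alpha \in unitmx) :
  [/\ algorithm_terminates G alpha s mu,
      (exists ds : 'cV[R]_n, algorithm_outputs G alpha s mu ds)
    & forall ds : 'cV[R]_n,
        algorithm_outputs G alpha s mu ds -> optimal G alpha s mu ds].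
Proof.
split=> [||ds [st [run st_halted <-]]].
- exact: iteration_Acc.
- have [st [run st_halted]] := exists_run G alpha s (initial n mu).
  by exists (modification st), st.
- have [lam inv] := greedy_inv_run hs run (greedy_inv_initial G alpha hs hmu).
  exact (greedy_inv_optimal hs inv st_halted).
Qed.
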